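(* $\mathrm{NID}\notin\Pi_2$.
   Context: Fix a universal prefix-free machine $U$. $K$ denotes prefix-free Kolmogorov complexity and $K(x\mid y)$ conditional prefix-free complexity. For binary strings $x,y$ let $E(x,y)=\max\{K(x\mid y),K(y\mid x)\}$ and $\mathrm{NID}(x,y)=\dfrac{E(x,y)}{\max\{K(x),K(y)\}}$, a rational-valued function on pairs of strings. The oscillation classes: an approximation of $F$ is a computable $f$ with $\lim_{s\to\infty}f(z,s)=F(z)$ for all $z$; $F\in\Sigma_1$ if it has an approximation nondecreasing in $s$; $F\in\Pi_1$ if it has one nonincreasing in $s$; $F\in\Sigma_{n+1}$ if it has a computable approximation $f$ such that for every $z$ there is $s_z$ with $f(z,t)$ nondecreasing for $t<s_z$ and $(f(z,t))_{t\geq s_z}$ a $\Pi_n$-approximation; $F\in\Pi_{n+1}$ likewise with nonincreasing for $t<s_z$ and $(f(z,t))_{t\geq s_z}$ a $\Sigma_n$-approximation. So $\Pi_2$ means an approximation that on each input first goes down (nonincreasing) and then goes up (nondecreasing). *)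

(* Defs.v *)
From HB Require Import structures.
From mathcomp Require Import all_boot all_order all_algebra.
From Stdlib Require Import ClassicalEpsilon.
Set Implicit Arguments. Unset Strict Implicit. Unset Printing Implicit Defensive.
Import Order.TTheory GRing.Theory Num.Theory.

(* Model of computation: Kleene's mu-recursive functions on nat,       *)
(* with a fuel-indexed evaluator.  A (partial) function is computable  *)
(* iff it is computed by some program [prog].                          *)
Inductive prog : Type :=
  | Zero : prog
  | Succ : prog
  | Proj : nat -> prog
  | Comp : prog -> seq prog -> prog
  | PRec : prog -> prog -> prog
  | Mu   : prog -> prog.

Fixpoint eval (n : nat) (p : prog) (args : seq nat) {struct n} : option nat :=
  match n with
  | 0 => None
  | n'.+1 =>
    match p with
    | Zero => Some 0
    | Succ => Some (head 0 args).+1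
    | Proj i => Some (nth 0 args i)
    | Comp f gs =>
        let vs := map (fun g => eval n' g args) gs in
        if all (fun o => o != None) vs then eval n' f (map (odflt 0) vs) else None
    | PRec f g =>
        match args with
        | [::] => eval n' f [::]
        | 0 :: xs => eval n' f xs
        | y.+1 :: xs =>
            match eval n' (PRec f g) (y :: xs) with
            | Some r => eval n' g (y :: r :: xs)
            | None => None
            end
        end
    | Mu f =>
        (fix search (m k : nat) {struct m} : option nat :=
           match m with
           | 0 => None
           | m'.+1 =>
               match eval n' f (k :: args) with
               | Some 0 => Some k
               | Some _ => search m' k.+1
               | None => None
               end
           end) n' 0
    end
  end.

Definition runs (e : prog) (args : seq nat) (v : nat) : Prop :=
  exists n, eval n e args = Some v.

(* bijection {0,1}^* -> nat *)
Fixpoint encS (s : seq bool) : nat :=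
  match s with
  | [::] => 0
  | b :: s' => (encS s').*2 + 1 + b
  end.

Definition pairN (a b : nat) : nat := ((a + b) * (a + b).+1)./2 + b.

Definition zig (z : int) : nat :=
  match z with Posz n => n.*2 | Negz n => n.*2.+1 end.

(* injective coding of rationals (via the canonical reduced form) *)
Definition encQ (q : rat) : nat := pairN (zig (numq q)) (absz (denq q)).

Definition mrun (M : prog) (p y x : seq bool) : Prop :=
  runs M [:: encS p; encS y] (encS x).

Definition mhalts (M : prog) (p y : seq bool) : Prop := exists x, mrun M p y x.

Definition prefix_free_machine (M : prog) : Prop :=
  forall y p q, mhalts M p y -> mhalts M q y -> prefix p q -> p = q.

Definition universal_pf (U : prog) : Prop :=
  prefix_free_machine U /\
  forall M, prefix_free_machine M ->
    exists rho : seq bool, forall p y x, mrun U (rho ++ p) y x <-> mrun M p y x.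

Definition pb (P : Prop) : bool :=
  if excluded_middle_informative P then true else false.

Definition Kdesc (U : prog) (x y : seq bool) (k : nat) : bool :=
  pb (exists p, size p = k /\ mrun U p y x).

Lemma Kdesc_ex_of (U : prog) (x y : seq bool) :
  (exists p, mrun U p y x) -> exists k, Kdesc U x y k.
Proof.
move=> [p Hp]; exists (size p); rewrite /Kdesc /pb.
case: excluded_middle_informative => // H; exfalso; apply: H; by exists p.
Qed.

(* K(x | y) = min { |p| : U(p, y) = x }  (0 if there is none, which never
   happens for universal U) *)
Definition Kc (U : prog) (x y : seq bool) : nat :=
  match excluded_middle_informative (exists p, mrun U p y x) with
  | left H => ex_minn (Kdesc_ex_of H)
  | right _ => 0
  end.

Definition K (U : prog) (x : seq bool) : nat := Kc U x [::].

Definition Einf (U : prog) (x y : seq bool) : nat := maxn (Kc U x y) (Kc U y x).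

Definition NID (U : prog) (x y : seq bool) : rat :=
  ((Einf U x y)%:R / (maxn (K U x) (K U y))%:R)%R.

Definition computable_approx (f : seq bool -> seq bool -> nat -> rat) : Prop :=
  exists e : prog, forall x y s, runs e [:: encS x; encS y; s] (encQ (f x y s)).

Definition converges_to (g : nat -> rat) (L : rat) : Prop :=
  forall eps : rat, (0 < eps)%R -> exists S, forall s, S <= s -> (`|g s - L| < eps)%R.

Definition approximates (f : seq bool -> seq bool -> nat -> rat)
  (F : seq bool -> seq bool -> rat) : Prop :=
  computable_approx f /\ forall x y, converges_to (f x y) (F x y).

Definition mono (sigma : bool) (g : nat -> rat) (P : nat -> Prop) : Prop :=
  forall t t', t <= t' -> P t -> P t' ->
    if sigma then (g t <= g t')%R else (g t' <= g t)%R.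

(* osc sigma n g : the sequence g has the shape of a Sigma_{n+1}
   (sigma = true) resp. Pi_{n+1} (sigma = false) approximation. *)
Fixpoint osc (sigma : bool) (n : nat) (g : nat -> rat) : Prop :=
  match n with
  | 0 => mono sigma g (fun _ => True)
  | k.+1 => exists s0, mono sigma g (fun t => t < s0) /\
                       osc (~~ sigma) k (fun t => g (s0 + t))
  end.

(* F in Sigma_n (sigma = true) / Pi_n (sigma = false), for n >= 1 *)
Definition in_osc_class (sigma : bool) (n : nat) (F : seq bool -> seq bool -> rat) : Prop :=
  exists f, approximates f F /\ forall x y, osc sigma n.-1 (f x y).

Definition Pi2 (F : seq bool -> seq bool -> rat) : Prop := in_osc_class false 2 F.

(* Main.v *)
Require Import Defs.
From mathcomp Require Import all_boot all_order all_algebra.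
From mathcomp Require Import zify.
From Stdlib Require Import Classical ClassicalEpsilon.
Set Implicit Arguments. Unset Strict Implicit. Unset Printing Implicit Defensive.
Import Order.TTheory GRing.Theory Num.Theory.

(** Let [f] be a Pi_2 approximation of NID.  Once [f] has been seen to rise from
    below 1/3 to at least 1/3 it cannot come down again, so NID is then at least
    1/3.  Consider [y = (m, u, 0^m)] and [x = (m, u, v)] with [|v| = m]; always
    [E(x, y) <= m + O(1)].

    If [K(y) >= 4 m], which happens for some [u], then [NID(y, x) < 1/3] for every
    [v], so [f] is eventually below 1/3 for all of them.  Let [u_m] be the first
    [u] for which this is observed.  As [u_m] is computable from [m], both
    complexities drop to [2 m + O(1)], whereas some [v] still has [K(x | y) >= m];
    hence NID exceeds 1/3 and [f] must rise for that [v].  Let [v_m] be the first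
    [v] for which the rise is observed.  Now [x] and [y] are computable from each
    other, so [E(x, y) = O(1)], while [K(y)] is unbounded in [m]: the NID of these
    pairs falls below 1/3 for some [m], which is impossible. *)

(** * Fuel-indexed evaluation *)

(** A named copy of the loop inside [eval] for [Mu]. It is convertible with that loop, so facts
    about minimisation can be proved by induction here. *)
Definition search (ev : nat -> option nat) :=
  fix search (m k : nat) {struct m} : option nat :=
    match m with
    | 0 => None
    | m'.+1 =>
        match ev k with
        | Some 0 => Some k
        | Some _ => search m' k.+1
        | None => None
        end
    end.

Lemma search_mono (ev ev' : nat -> option nat) m m' k v :
  (forall j w, ev j = Some w -> ev' j = Some w) -> m <= m' ->
  search ev m k = Some v -> search ev' m' k = Some v.
Proof.
move=> sub; elim: m m' k => [//|m IH] [//|m'] k; rewrite ltnS => le_m /=.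
case E: (ev k) => [[|w]|//]; rewrite (sub _ _ E) //.
exact: IH.
Qed.

Lemma search_root ev m k v : search ev m k = Some v -> ev v = Some 0.
Proof.
elim: m k => [//|m IH] k /=.
by case E: (ev k) => [[|w]|//]; [case=> <- | apply: IH].
Qed.

Lemma search_found (ev : nat -> option nat) m k d :
  ev (k + d) = Some 0 -> (forall j, j < d -> exists w, ev (k + j) = Some w.+1) ->
  d < m -> search ev m k = Some (k + d).
Proof.
elim: m k d => [//|m IH] k [|d] root pos; rewrite ?ltnS => le_d /=.
  by rewrite addn0 in root *; rewrite root.
have [w] := pos 0 isT; rewrite addn0 => ->.
rewrite addnS -addSn; apply: IH => //; first by rewrite addSn -addnS.
by move=> j lt_j; rewrite addSn -addnS; apply: pos.
Qed.

(** Extra fuel never changes a value already obtained. Hence [runs] is single-valued, and the fuels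
    of several subcomputations can be replaced by their maximum. *)
Lemma eval_mono n n' p a v :
  n <= n' -> eval n p a = Some v -> eval n' p a = Some v.
Proof.
elim: n n' p a v => [//|n IH] [//|n'] p a v; rewrite ltnS => le_n.
case: p => [||i|f gs|f g|f] //.
- rewrite /=; case: ifP => // all_gs.
  suff -> : [seq eval n' g a | g <- gs] = [seq eval n g a | g <- gs].
    by rewrite all_gs; apply: IH.
  elim: gs all_gs => [//|g gs IHgs] /= /andP [g_ok /IHgs ->].
  by case E: (eval n g a) g_ok => [w|//] _; rewrite (IH _ _ _ _ le_n E).
- rewrite /=; case: a => [|[|y] xs]; try exact: IH.
  case E: (eval n (PRec f g) (y :: xs)) => [r|//].
  by rewrite (IH _ _ _ _ le_n E); apply: IH.
- rewrite -![eval _.+1 _ _]/(search (fun k => eval _ f (k :: a)) _ 0).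
  by apply: search_mono => // j w; apply: IH.
Qed.

Lemma runs_fun p a v w : runs p a v -> runs p a w -> v = w.
Proof.
move=> [n En] [n' En'].
have := eval_mono (leq_maxl n n') En.
by rewrite (eval_mono (leq_maxr n n') En') => -[].
Qed.

Definition runs_all (gs : seq prog) a vs :=
  exists n, [seq eval n g a | g <- gs] = [seq Some v | v <- vs].

Lemma eval_map_mono n n' gs a vs : n <= n' ->
  [seq eval n g a | g <- gs] = [seq Some v | v <- vs] ->
  [seq eval n' g a | g <- gs] = [seq Some v | v <- vs].
Proof.
move=> le_n; elim: gs vs => [|g gs IH] [|v vs] //= [Eg /IH ->].
by rewrite (eval_mono le_n Eg).
Qed.

Lemma runs_all_nil a : runs_all [::] a [::].
Proof. by exists 0. Qed.

Lemma runs_all_cons g gs a v vs :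
  runs g a v -> runs_all gs a vs -> runs_all (g :: gs) a (v :: vs).
Proof.
move=> [n En] [n' En']; exists (maxn n n') => /=.
by rewrite (eval_mono (leq_maxl n n') En) (eval_map_mono (leq_maxr n n') En').
Qed.

Lemma runs_all_proj (a : seq nat) (s : seq nat) :
  runs_all [seq Proj i | i <- s] a [seq nth 0 a i | i <- s].
Proof. by exists 1; rewrite -!map_comp; apply: eq_map. Qed.

Lemma runs_comp f gs a vs v :
  runs_all gs a vs -> runs f vs v -> runs (Comp f gs) a v.
Proof.
move=> [n En] [n' En']; exists (maxn n n').+1 => /=.
rewrite (eval_map_mono (leq_maxl n n') En) all_map /= all_predT.
by rewrite -map_comp map_id; apply: eval_mono En'; apply: leq_maxr.
Qed.

Lemma runs_comp_inv f g gs a v :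
  runs (Comp f (g :: gs)) a v -> exists w, runs g a w.
Proof.
move=> [[|n] //=]; case E: (eval n g a) => [w|//] _.
by exists w, n.
Qed.

Lemma runs_mu f a k (h : nat -> nat) :
  (forall j, j <= k -> runs f (j :: a) (h j)) -> h k = 0 ->
  (forall j, j < k -> 0 < h j) -> runs (Mu f) a k.
Proof.
move=> Hf hk hpos.
have [n Hn] : exists n, forall j, j <= k -> eval n f (j :: a) = Some (h j).
  elim: k Hf {hk hpos} => [|k IH] Hf.
    have [n En] := Hf 0 (leqnn 0); exists n => j.
    by rewrite leqn0 => /eqP ->.
  have [|n Hn] := IH; first by move=> j le_j; apply/Hf/leqW.
  have [n' En'] := Hf k.+1 (leqnn _).
  exists (maxn n n') => j; rewrite leq_eqVlt => /orP [/eqP ->|].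
    exact: eval_mono (leq_maxr _ _) En'.
  by rewrite ltnS => /Hn; apply: eval_mono (leq_maxl _ _).
(* The same fuel serves each call of [f] and bounds the number of candidates tried, and [k.+1]
   candidates are needed. *)
exists (maxn n k.+1).+1.
rewrite -[eval _ _ _]/(search (fun j => eval (maxn n k.+1) f (j :: a)) _ 0).
rewrite -[k in RHS]add0n; apply: search_found; last exact: leq_maxr.
- by rewrite add0n -hk; apply/eval_mono/Hn; rewrite ?leq_maxl.
- move=> j lt_j; exists (h j).-1; rewrite prednK ?hpos // add0n.
  by apply/eval_mono/Hn; rewrite ?leq_maxl // ltnW.
Qed.

Lemma runs_mu_inv f a k : runs (Mu f) a k -> runs f (k :: a) 0.
Proof.
move=> [[|n] //].
rewrite -[eval _ _ _]/(search (fun j => eval n f (j :: a)) _ 0).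
by move/search_root=> E; exists n.
Qed.

(** * Total recursive functions and their closure properties *)

(** Only lists of length [n] matter. Predicates are covered through the coercion of [bool] to
    [nat]. *)
Definition recursive (n : nat) (F : seq nat -> nat) :=
  exists p, forall a, size a = n -> runs p a (F a).

Definition unary (h : nat -> nat) := exists p, forall x, runs p [:: x] (h x).
Definition binary (h : nat -> nat -> nat) :=
  exists p, forall x y, runs p [:: x; y] (h x y).
Definition ternary (h : nat -> nat -> nat -> nat) :=
  exists p, forall x y z, runs p [:: x; y; z] (h x y z).

Lemma unaryI h : recursive 1 (fun a => h (nth 0 a 0)) -> unary h.
Proof. by move=> [p Hp]; exists p => x; apply: (Hp [:: x]). Qed.

Lemma binaryI h : recursive 2 (fun a => h (nth 0 a 0) (nth 0 a 1)) -> binary h.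
Proof. by move=> [p Hp]; exists p => x y; apply: (Hp [:: x; y]). Qed.

Lemma ternaryI h :
  recursive 3 (fun a => h (nth 0 a 0) (nth 0 a 1) (nth 0 a 2)) -> ternary h.
Proof. by move=> [p Hp]; exists p => x y z; apply: (Hp [:: x; y; z]). Qed.

Lemma rec_eq n F G :
  (forall a, size a = n -> F a = G a) -> recursive n F -> recursive n G.
Proof. by move=> FG [p Hp]; exists p => a sa; rewrite -FG //; apply: Hp. Qed.

Section Closure.
Variable n : nat.
Implicit Types F G H : seq nat -> nat.

Lemma rec_unary h F : unary h -> recursive n F -> recursive n (fun a => h (F a)).
Proof.
move=> [p Hp] [f Hf]; exists (Comp p [:: f]) => a sa.
apply: runs_comp (Hp _); apply: runs_all_cons; first exact: Hf.
exact: runs_all_nil.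
Qed.

Lemma rec_binary h F G : binary h -> recursive n F -> recursive n G ->
  recursive n (fun a => h (F a) (G a)).
Proof.
move=> [p Hp] [f Hf] [g Hg]; exists (Comp p [:: f; g]) => a sa.
apply: runs_comp (Hp _ _); apply: runs_all_cons; first exact: Hf.
by apply: runs_all_cons; [exact: Hg | exact: runs_all_nil].
Qed.

Lemma rec_ternary h F G H : ternary h -> recursive n F -> recursive n G ->
  recursive n H -> recursive n (fun a => h (F a) (G a) (H a)).
Proof.
move=> [p Hp] [f Hf] [g Hg] [k Hk]; exists (Comp p [:: f; g; k]) => a sa.
apply: runs_comp (Hp _ _ _); apply: runs_all_cons; first exact: Hf.
apply: runs_all_cons; first exact: Hg.
by apply: runs_all_cons; [exact: Hk | exact: runs_all_nil].
Qed.

Lemma rec_nth i : recursive n (fun a => nth 0 a i).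
Proof. by exists (Proj i) => a _; exists 1. Qed.

(** Bounded operators put their index at the head of the argument list, so an outer variable is read
    through one [behead] per binder. *)
Lemma rec_nth1 i : recursive n (fun a => nth 0 (behead a) i).
Proof. by exists (Proj i.+1) => a _; exists 1; rewrite nth_behead. Qed.

Lemma rec_nth2 i : recursive n (fun a => nth 0 (behead (behead a)) i).
Proof. by exists (Proj i.+2) => a _; exists 1; rewrite !nth_behead. Qed.

Lemma rec_succ F : recursive n F -> recursive n (fun a => (F a).+1).
Proof. by apply: rec_unary; exists Succ => x; exists 1. Qed.

Lemma rec_const c : recursive n (fun=> c).
Proof.
elim: c => [|c IH]; first by exists Zero => a _; exists 1.
exact: rec_succ.
Qed.

Lemma rec_prec F G H : recursive n F -> recursive n.+2 G ->
  (forall xs, size xs = n -> H (0 :: xs) = F xs) ->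
  (forall y xs, size xs = n -> H (y.+1 :: xs) = G [:: y, H (y :: xs) & xs]) ->
  recursive n.+1 H.
Proof.
move=> [f Hf] [g Hg] H0 HS; exists (PRec f g) => -[//|y xs] [sxs].
elim: y => [|y [k Ek]].
  by rewrite H0 //; have [k Ek] := Hf xs sxs; exists k.+1.
have [k' Ek'] := Hg [:: y, H (y :: xs) & xs] (congr1 (fun k => k.+2) sxs).
exists (maxn k k').+1; rewrite HS //=.
rewrite (eval_mono (leq_maxl k k') Ek).
exact: eval_mono (leq_maxr k k') Ek'.
Qed.

End Closure.

Lemma binary_prec (h : nat -> nat -> nat) F G :
  recursive 1 F -> recursive 3 G -> (forall x, h 0 x = F [:: x]) ->
  (forall y x, h y.+1 x = G [:: y; h y x; x]) -> binary h.
Proof.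
move=> RF RG h0 hS; apply: binaryI.
by apply: (rec_prec RF RG) => [[|x []]|y [|x []]] //=.
Qed.

Lemma unary_of_binary h : binary (fun x _ => h x) -> unary h.
Proof.
move=> bh; apply: unaryI.
by apply: (@rec_binary 1 (fun x _ => h x) _ (fun=> 0)) => //;
  [exact: rec_nth | exact: rec_const].
Qed.

Lemma add_binary : binary addn.
Proof.
apply: (@binary_prec _ (fun a => nth 0 a 0) (fun a => (nth 0 a 1).+1)) => //.
- exact: rec_nth.
- exact/rec_succ/rec_nth.
Qed.

Lemma rec_add n F G :
  recursive n F -> recursive n G -> recursive n (fun a => F a + G a).
Proof. exact: rec_binary add_binary. Qed.

(** Primitive recursion on the bound, placed at the head of the list. Unpairing and bounded
    quantifiers are built from such sums. *)
Lemma rec_bsum n (B : seq nat -> nat) (F : nat -> seq nat -> nat) :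
  recursive n B ->
  recursive n.+1 (fun a => F (nth 0 a 0) (behead a)) ->
  recursive n (fun a => \sum_(0 <= i < B a) F i a).
Proof.
move=> [b Hb] [f Hf].
pose H := fun a => \sum_(0 <= i < nth 0 a 0) F i (behead a).
have [h Hh] : recursive n.+1 H.
  pose G := fun a => nth 0 a 1 + F (nth 0 a 0) (behead (behead a)).
  apply: (@rec_prec _ (fun=> 0) G); first exact: rec_const.
  - apply: rec_add; first exact: rec_nth.
    (* These projections drop the partial sum [r], which sits at position 1. *)
    exists (Comp f [seq Proj i | i <- 0 :: iota 2 n]) => -[|x [|r xs]] // [sxs].
    apply: runs_comp (runs_all_proj _ _) _.
    have -> : [seq nth 0 [:: x, r & xs] i | i <- 0 :: iota 2 n] = x :: xs.
      rewrite /= (iotaDl 2 0) -map_comp -sxs; congr cons.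
      by rewrite -[RHS](mkseq_nth 0).
    by apply: Hf; rewrite /= sxs.
  - by move=> xs _; rewrite /H /= big_nil.
  - by move=> y xs _; rewrite /H /G /= big_nat_recr.
exists (Comp h (b :: [seq Proj i | i <- iota 0 n])) => a sa.
apply: (@runs_comp _ _ _ (B a :: a)); last by apply: Hh; rewrite /= sa.
apply: runs_all_cons; first exact: Hb.
have := runs_all_proj a (iota 0 n).
by rewrite -{2}sa -/(mkseq (nth 0 a) (size a)) mkseq_nth.
Qed.

Lemma rec_mul n F G :
  recursive n F -> recursive n G -> recursive n (fun a => F a * G a).
Proof.
apply: rec_binary.
apply: (@binary_prec _ (fun=> 0) (fun a => nth 0 a 2 + nth 0 a 1)) => //.
- exact: rec_const.
- by apply: rec_add; apply: rec_nth.
Qed.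

Lemma rec_pred n F : recursive n F -> recursive n (fun a => (F a).-1).
Proof.
apply: rec_unary; apply: unary_of_binary.
apply: (@binary_prec _ (fun=> 0) (fun a => nth 0 a 0)) => //.
- exact: rec_const.
- exact: rec_nth.
Qed.

Lemma rec_sub n F G :
  recursive n F -> recursive n G -> recursive n (fun a => F a - G a).
Proof.
(* The arguments are swapped because [binary_prec] recurses on the first one. *)
move=> RF RG; apply: (@rec_binary n (fun y x => x - y)) => //.
apply: (@binary_prec _ (fun a => nth 0 a 0) (fun a => (nth 0 a 1).-1)).
- exact: rec_nth.
- exact/rec_pred/rec_nth.
- by move=> x; rewrite subn0.
- by move=> y x; rewrite subnS.
Qed.

Lemma rec_exp2 n F : recursive n F -> recursive n (fun a => 2 ^ F a).
Proof.
apply: rec_unary; apply: unary_of_binary.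
apply: (@binary_prec _ (fun=> 1) (fun a => nth 0 a 1 + nth 0 a 1)) => //.
- exact: rec_const.
- by apply: rec_add; apply: rec_nth.
- by move=> y x; rewrite expnS mul2n -addnn.
Qed.

Lemma rec_eq0 n F : recursive n F -> recursive n (fun a => F a == 0).
Proof.
move=> RF; apply: (@rec_eq _ (fun a => 1 - F a)).
  by move=> a _; case: (F a).
by apply: rec_sub => //; apply: rec_const.
Qed.

Lemma rec_leq n F G : recursive n F -> recursive n G ->
  recursive n (fun a => F a <= G a).
Proof. by move=> RF RG; apply/rec_eq0/rec_sub. Qed.

Lemma rec_negb n (b : seq nat -> bool) : recursive n b -> recursive n (fun a => ~~ b a).
Proof.
by move=> /rec_eq0; apply: rec_eq => a _; case: (b a).
Qed.

Lemma rec_andb n (b c : seq nat -> bool) : recursive n b -> recursive n c ->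
  recursive n (fun a => b a && c a).
Proof.
by move=> Rb /(rec_mul Rb); apply: rec_eq => a _; rewrite mulnb.
Qed.

Lemma rec_orb n (b c : seq nat -> bool) : recursive n b -> recursive n c ->
  recursive n (fun a => b a || c a).
Proof.
move=> /rec_negb Rb /rec_negb /(rec_andb Rb) /rec_negb.
by apply: rec_eq => a _; rewrite negb_and !negbK.
Qed.

Lemma rec_eqn n F G : recursive n F -> recursive n G ->
  recursive n (fun a => F a == G a).
Proof.
move=> RF RG; have := rec_andb (rec_leq RF RG) (rec_leq RG RF).
by apply: rec_eq => a _; rewrite eqn_leq.
Qed.

Lemma rec_odd n F : recursive n F -> recursive n (fun a => odd (F a)).
Proof.
apply: (@rec_unary _ (fun x => odd x)).
apply: unary_of_binary.
apply: (@binary_prec _ (fun=> 0) (fun a => nth 0 a 1 == 0)) => //.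
- exact: rec_const.
- exact/rec_eq0/rec_nth.
- by move=> y x /=; case: (odd y).
Qed.

Lemma rec_half n F : recursive n F -> recursive n (fun a => (F a)./2).
Proof.
apply: rec_unary; apply: unary_of_binary.
apply: (@binary_prec _ (fun=> 0) (fun a => odd (nth 0 a 0) + nth 0 a 1)) => //.
- exact: rec_const.
- by apply: rec_add; [apply: rec_odd|]; apply: rec_nth.
- by move=> y x; rewrite /= uphalf_half.
Qed.

Lemma rec_mu n (h : nat -> seq nat -> nat) :
  recursive n.+1 (fun a => h (nth 0 a 0) (behead a)) ->
  forall ex : (forall a, exists k, h k a == 0),
  recursive n (fun a => ex_minn (ex a)).
Proof.
move=> [p Hp] ex; exists (Mu p) => a sa.
case: ex_minnP => k /eqP hk kmin.
apply: (@runs_mu _ _ _ (fun j => h j a)) => // [j _|j lt_j].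
  by apply: (Hp (j :: a)); rewrite /= sa.
rewrite lt0n; apply/negP => /kmin; by rewrite leqNgt lt_j.
Qed.

Ltac rec_step :=
  first [ apply: rec_const | apply: rec_nth | apply: rec_nth1 | apply: rec_nth2
        | apply: rec_succ | apply: rec_add | apply: rec_mul | apply: rec_pred
        | apply: rec_sub | apply: rec_exp2 | apply: rec_half | apply: rec_negb
        | apply: rec_andb | apply: rec_orb | apply: rec_odd | apply: rec_eqn
        | apply: rec_leq | apply: rec_bsum ].

(** * Cantor pairing and its inverse *)

Lemma rec_pairN n F G :
  recursive n F -> recursive n G -> recursive n (fun a => pairN (F a) (G a)).
Proof.
apply: rec_binary; apply: binaryI; rewrite /pairN; do !rec_step.
Qed.

Definition tri n := (n * n.+1)./2.

Lemma triS n : tri n.+1 = tri n + n.+1.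
Proof.
rewrite /tri (_ : n.+1 * n.+2 = n * n.+1 + n.+1.*2); last by rewrite -mul2n; nia.
by rewrite halfD doubleK odd_double andbF.
Qed.

Lemma leq_tri m n : m <= n -> tri m <= tri n.
Proof. by move=> le_mn; apply/half_leq/leq_mul. Qed.

(** The pairs with sum [s] take values from [tri s] to [tri s + s], below [tri s.+1], so distinct
    diagonals have disjoint ranges. *)
Lemma pairN_inj a b c d : pairN a b = pairN c d -> a = c /\ b = d.
Proof.
rewrite /pairN -/(tri (a + b)) -/(tri (c + d)) => E.
have low x y z w : x + y < z + w -> tri (x + y) + y < tri (z + w) + w.
  move/leq_tri; rewrite triS; lia.
have [/low|/low|Es] := ltngtP (a + b) (c + d); first lia; first lia.
rewrite Es in E; lia.
Qed.

Lemma leq_pairNl a b : a <= pairN a b.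
Proof.
rewrite /pairN -/(tri (a + b)); case: (a + b) (leq_addr b a) => [|s]; first lia.
rewrite triS; lia.
Qed.

Lemma leq_pairNr a b : b <= pairN a b.
Proof. exact: leq_addl. Qed.

(** At most one term of this sum is nonzero, by injectivity of the pairing; written as a bounded
    sum, decoding is visibly recursive. *)
Definition unpair (h : nat -> nat -> nat) n :=
  \sum_(0 <= a < n.+1) \sum_(0 <= b < n.+1) (pairN a b == n) * h a b.

Lemma unpairK h a b : unpair h (pairN a b) = h a b.
Proof.
have la : a < (pairN a b).+1 by rewrite ltnS leq_pairNl.
have lb : b < (pairN a b).+1 by rewrite ltnS leq_pairNr.
rewrite /unpair big_mkord (bigD1 (Ordinal la)) //= [X in _ + X]big1 => [|i ne_i].
  rewrite addn0 big_mkord (bigD1 (Ordinal lb)) //= [X in _ + X]big1 => [|j ne_j].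
    by rewrite eqxx mul1n addn0.
  case: eqP => [/pairN_inj [_ E]|//]; case/eqP: ne_j; exact: val_inj.
rewrite big_mkord big1 // => j _.
case: eqP => [/pairN_inj [E _]|//]; case/eqP: ne_i; exact: val_inj.
Qed.

Lemma rec_unpair n h F : binary h -> recursive n F ->
  recursive n (fun a => unpair h (F a)).
Proof.
move=> bh; apply: rec_unary; apply: unaryI; rewrite /unpair.
do !rec_step; by apply: (rec_binary bh); rec_step.
Qed.

Definition pi1 := unpair (fun a _ => a).
Definition pi2 := unpair (fun _ b => b).

Lemma pi1K a b : pi1 (pairN a b) = a. Proof. exact: unpairK. Qed.
Lemma pi2K a b : pi2 (pairN a b) = b. Proof. exact: unpairK. Qed.

Lemma rec_pi1 n F : recursive n F -> recursive n (fun a => pi1 (F a)).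
Proof. by apply: rec_unpair; apply: binaryI; rec_step. Qed.

Lemma rec_pi2 n F : recursive n F -> recursive n (fun a => pi2 (F a)).
Proof. by apply: rec_unpair; apply: binaryI; rec_step. Qed.

Ltac rec_solve :=
  do !first [ apply: rec_pi1 | apply: rec_pi2 | apply: rec_pairN | rec_step ].

(** * Codes of strings and their lengths *)

Lemma encS_inj : injective encS.
Proof.
elim=> [|b s IH] [|c t] //=; try lia.
move=> E; have [Eb Es] : b = c /\ encS s = encS t by move: E; case: b; case: c; lia.
by rewrite Eb (IH _ Es).
Qed.

Lemma encS_surj n : exists s, encS s == n.
Proof.
elim/ltn_ind: n => -[|n] IH; first by exists [::].
have [|s /eqP Es] := IH n./2; first by lia.
by exists (odd n :: s); rewrite /= Es; apply/eqP; have := odd_double_half n; lia.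
Qed.

Definition decS n := xchoose (encS_surj n).

Lemma decSK n : encS (decS n) = n.
Proof. exact/eqP/(xchooseP (encS_surj n)). Qed.

Lemma encSK s : decS (encS s) = s.
Proof. by apply: encS_inj; rewrite decSK. Qed.

(** In binary, [(encS s).+1] is a leading 1 above the bits of [s], the head of [s] being the lowest.
    The length thus becomes an arithmetic condition on the code. *)
Lemma encS_bounds s : 2 ^ size s <= (encS s).+1 < 2 ^ (size s).+1.
Proof. by elim: s => [//|b s IH] /=; rewrite !expnS in IH *; lia. Qed.

Lemma size_decS n m : (size (decS n) == m) = (2 ^ m <= n.+1 < 2 ^ m.+1).
Proof.
have := encS_bounds (decS n); rewrite decSK => /andP [lo hi].
apply/eqP/idP => [<-|/andP [lo' hi']]; first by rewrite lo.
have := leq_ltn_trans lo hi'; have := leq_ltn_trans lo' hi.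
by rewrite !ltn_exp2l // !ltnS => le1 le2; apply/eqP; rewrite eqn_leq le1 le2.
Qed.

(** The header of [m] ones and a zero is self-delimiting; this arithmetic form lets a machine
    recognise it on codes. *)
Lemma encS_unary m v :
  (encS (nseq m true ++ false :: v)).+2 = 2 ^ m * (2 * encS v + 3).
Proof. by elim: m => [|m IH] /=; [lia | rewrite expnS; lia]. Qed.

Lemma prefix_unary m m' (v v' : seq bool) :
  prefix (nseq m true ++ false :: v) (nseq m' true ++ false :: v') ->
  m = m' /\ prefix v v'.
Proof. by elim: m m' => [|m IH] [|m'] //= /IH [->]. Qed.

Lemma prefix_eq_size (s t : seq bool) : prefix s t -> size s = size t -> s = t.
Proof.
by case/prefixP=> r ->; rewrite size_cat; case: r => [|b r] /=; rewrite ?cats0 //; lia.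
Qed.

(** * Prefix-free machines and bounds on complexity *)

Definition prefix_code (D : nat -> Prop) :=
  forall p q, D (encS p) -> D (encS q) -> prefix p q -> p = q.

(** On [p] and [z] the machine looks for the least certificate [k] with [P k p z] and outputs
    [F k p z]. The least certificate may differ from a given one, so [F] must agree on all of
    them. *)
Lemma machine_exists (P : nat -> nat -> nat -> bool) F :
  ternary (fun k p z => ~~ P k p z) -> ternary F ->
  (forall k k' p z, P k p z -> P k' p z -> F k p z = F k' p z) ->
  exists M, (forall k p z, P k p z -> runs M [:: p; z] (F k p z)) /\
    (forall p z v, runs M [:: p; z] v -> exists k, P k p z).
Proof.
move=> [f Hf] [g Hg] F_fun.
exists (Comp g [:: Mu f; Proj 0; Proj 1]); split=> [k p z Pk | p z v].
  case: (ex_minnP (ex_intro (fun k => P k p z) k Pk)) => j Pj j_min.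
  rewrite (F_fun k j p z Pk Pj); apply: runs_comp (Hg _ _ _).
  apply: runs_all_cons; last exact: (@runs_all_proj [:: p; z] [:: 0; 1]).
  apply: (@runs_mu _ _ _ (fun i => ~~ P i p z)) => //; first by rewrite Pj.
  move=> i lt_i; rewrite lt0b; apply/negP => /j_min; by rewrite leqNgt lt_i.
(* Composition is strict, so a halting run forces [Mu f] to have found a certificate. *)
move/runs_comp_inv=> [k /runs_mu_inv run0]; exists k.
by have := runs_fun (Hf k p z) run0; case: (P k p z).
Qed.

Section Complexity.
Variables (U : prog) (HU : universal_pf U).

Lemma mrun_fun p y x x' : mrun U p y x -> mrun U p y x' -> x = x'.
Proof. by move=> r r'; apply/encS_inj/(runs_fun r r'). Qed.

Lemma Kc_le p y x : mrun U p y x -> Kc U x y <= size p.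
Proof.
rewrite /Kc => r; case: excluded_middle_informative => // H.
case: ex_minnP => k _; apply; rewrite /Kdesc /pb.
by case: excluded_middle_informative => // nex; case: nex; exists p.
Qed.

Lemma mrun_of_code P F :
  ternary (fun k p z => ~~ P k p z) -> ternary F ->
  (forall k k' p z, P k p z -> P k' p z -> F k p z = F k' p z) ->
  (forall z, prefix_code (fun p => exists k, P k p z)) ->
  exists rho, forall k p z, P k (encS p) z ->
    mrun U (rho ++ p) (decS z) (decS (F k (encS p) z)).
Proof.
move=> RP RF F_fun code.
have [M [M_runs M_dom]] := machine_exists RP RF F_fun.
have [|rho Hrho] := HU.2 M.
  move=> y p q [x /M_dom hp] [x' /M_dom hq]; exact: code hp hq.
exists rho => k p z Pk; apply/Hrho; rewrite /mrun !decSK; exact: M_runs.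
Qed.

Lemma Kc_le_code P F :
  ternary (fun k p z => ~~ P k p z) -> ternary F ->
  (forall k k' p z, P k p z -> P k' p z -> F k p z = F k' p z) ->
  (forall z, prefix_code (fun p => exists k, P k p z)) ->
  exists c, forall k p z, P k (encS p) z ->
    Kc U (decS (F k (encS p) z)) (decS z) <= size p + c.
Proof.
move=> RP RF F_fun code; have [rho Hrho] := mrun_of_code RP RF F_fun code.
exists (size rho) => k p z /Hrho /Kc_le; by rewrite size_cat addnC.
Qed.

(** Apply universality to the machine that outputs [x] and halts on the empty program only, whose
    code is 0. The default value in [Kc] therefore never occurs. *)
Lemma mrun_total x y : exists p, mrun U p y x.
Proof.
have [||||rho Hrho] := @mrun_of_code (fun _ p _ => p == 0) (fun _ _ _ => encS x).
- by apply: ternaryI; rec_solve.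
- by apply: ternaryI; rec_solve.
- by [].
- by move=> z p q [_ /eqP Ep] [_ /eqP Eq] _; apply: encS_inj; rewrite Ep Eq.
- by exists (rho ++ [::]); have := Hrho 0 [::] (encS y) isT; rewrite !encSK.
Qed.

Lemma Kc_witness x y : exists2 p, size p = Kc U x y & mrun U p y x.
Proof.
rewrite /Kc; case: excluded_middle_informative => [H|[]]; last exact: mrun_total.
case: ex_minnP => k; rewrite /Kdesc /pb.
by case: excluded_middle_informative => // -[p [sp rp]] _ _; exists p.
Qed.

(** If the empty program halted, prefix-freeness would make it the only halting program, yet a
    second string also has a program. The denominator of [NID] is thus positive. *)
Lemma K_gt0 x : 0 < K U x.
Proof.
rewrite lt0n; apply/eqP => Kx0.
have [p] := Kc_witness x [::]; rewrite -/(K U x) Kx0 => /size0nil -> run_x.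
have [q run_q] := mrun_total (true :: x) [::].
have E : [::] = q by apply: (HU.1 [::]); rewrite ?prefix0s //; [exists x | exists (true :: x)].
rewrite -E in run_q; have := congr1 size (mrun_fun run_x run_q); rewrite /=; lia.
Qed.

(** Pigeonhole: there are [2 ^ k] candidates but only [(2 ^ k).-1] programs of length below [k], and
    a program has at most one output. *)
Lemma Kc_count (g : nat -> nat) y k : injective g ->
  exists2 i, i < 2 ^ k & k <= Kc U (decS (g i)) y.
Proof.
move=> g_inj; apply: NNPP => none.
have small i : i < 2 ^ k -> exists p, encS p < (2 ^ k).-1 /\ mrun U p y (decS (g i)).
  move=> lt_i; have [p sp rp] := Kc_witness (decS (g i)) y; exists p; split=> //.
  have lt_k : size p < k by rewrite sp ltnNge; apply/negP => le_k; apply: none; exists i.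
  have /andP [_ hi] := encS_bounds p.
  have := leq_trans hi (leq_pexp2l (isT : 0 < 2) lt_k); lia.
pose h (i : 'I_(2 ^ k)) : 'I_(2 ^ k).-1 :=
  let ex := constructive_indefinite_description _ (small i (ltn_ord i)) in
  Ordinal (proj1 (proj2_sig ex)).
have h_inj : injective h.
  move=> i j; rewrite /h; case: constructive_indefinite_description => p [lt_p rp].
  case: constructive_indefinite_description => q [lt_q rq] /= [/encS_inj Epq].
  rewrite Epq in rp; have /(congr1 encS) := mrun_fun rp rq.
  by rewrite !decSK => /g_inj /val_inj.
have := leq_card h h_inj; rewrite !card_ord; have := expn_gt0 2 k; lia.
Qed.

End Complexity.

(** * Bounded quantifiers and unbounded search *)

Lemma rec_has n B (b : nat -> seq nat -> bool) :
  recursive n B -> recursive n.+1 (fun a => b (nth 0 a 0) (behead a)) ->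
  recursive n (fun a => has (fun i => b i a) (iota 0 (B a))).
Proof.
move=> RB Rb; have := rec_negb (rec_eq0 (@rec_bsum _ _ (fun i a => b i a) RB Rb)).
apply: rec_eq => a _; rewrite /index_iota subn0; congr (nat_of_bool _).
elim: (iota 0 (B a)) => [|i s IH] /=; first by rewrite big_nil.
by rewrite big_cons addn_eq0 negb_and IH; case: (b i a).
Qed.

Lemma rec_all n B (b : nat -> seq nat -> bool) :
  recursive n B -> recursive n.+1 (fun a => b (nth 0 a 0) (behead a)) ->
  recursive n (fun a => all (fun i => b i a) (iota 0 (B a))).
Proof.
move=> RB Rb; have := rec_negb (@rec_has _ _ (fun i a => ~~ b i a) RB (rec_negb Rb)).
apply: rec_eq => a _; rewrite -all_predC; congr (nat_of_bool _).
by apply: eq_all => i /=; rewrite negbK.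
Qed.

Lemma hasIotaP (b : nat -> bool) n :
  reflect (exists2 i, i < n & b i) (has b (iota 0 n)).
Proof.
apply: (iffP hasP) => -[i]; rewrite ?mem_iota => lt_i bi; exists i => //.
by rewrite mem_iota.
Qed.

Lemma allIotaP (b : nat -> bool) n :
  reflect (forall i, i < n -> b i) (all b (iota 0 n)).
Proof.
by apply: (iffP allP) => H i; [have := H i|]; rewrite mem_iota //; apply: H.
Qed.

(** Turns existence into computable choice; both [u_m] and [v_m] are obtained from it. *)
Lemma search_unary (P : nat -> nat -> bool) m0 :
  recursive 2 (fun a => P (nth 0 a 1) (nth 0 a 0)) ->
  (forall m, m0 <= m -> exists k, P m k) ->
  exists2 h, unary h & forall m, m0 <= m -> P m (h m).
Proof.
move=> RP ex.
(* Below [m0] every [k] is accepted, which makes the minimisation total. *)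
pose Q k (a : seq nat) : nat := ~~ ((nth 0 a 0 < m0) || P (nth 0 a 0) k).
have exQ a : exists k, Q k a == 0.
  rewrite /Q; have [_|le_m] := ltnP (nth 0 a 0) m0; first by exists 0.
  by have [k Pk] := ex _ le_m; exists k; rewrite Pk.
exists (fun m => ex_minn (exQ [:: m])) => [|m le_m].
  have [p Hp] : recursive 1 (fun a => ex_minn (exQ a)).
    apply: rec_mu; rewrite /Q; do !rec_step.
    by move: RP; apply: rec_eq => -[|k [|m [|? ?]]].
  by exists p => m; apply: (Hp [:: m]).
by case: ex_minnP => k; rewrite /Q /= ltnNge le_m /=; case: (P m k).
Qed.

(** * The threshold 1/3 and limits of approximations *)

(** [zig] gives odd codes exactly to negative numerators and doubles the others, hence the factor 2
    before the denominator. *)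
Definition low n := odd (pi1 n) || (3 * pi1 n < 2 * pi2 n).

Lemma lowE q : low (encQ q) = (q < 3%:R^-1)%R.
Proof.
have -> : (q < 3%:R^-1)%R = (numq q * 3 < denq q)%R.
  rewrite -{1}(divq_num_den q) ltr_pdivrMr ?ltr0z ?denq_gt0 //.
  by rewrite mulrC ltr_pdivlMr ?ltr0n // -[3%:R%R]/(3%:~R)%R -intrM ltr_int.
rewrite /low /encQ pi1K pi2K.
have := denq_gt0 q; case: (numq q) => n /=; case: (denq q) => // d _ /=; lia.
Qed.

(** A rise across [q] cannot lie within the nonincreasing phase, so [t] is already in the
    nondecreasing phase and [g] stays at or above [q] from then on. *)
Lemma osc_limit_ge g l q s t : osc false 1 g -> converges_to g l ->
  s < t -> (g s < q)%R -> (q <= g t)%R -> (q <= l)%R.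
Proof.
move=> [s0 [down up]] cvg lt_st gs gt; rewrite leNgt; apply/negP => lt_l.
have [N HN] := cvg (q - l)%R (ltac:(by rewrite subr_gt0)).
have [lt_t|le_t] := ltnP t s0.
  have := down s t (ltnW lt_st) (ltn_trans lt_st lt_t) lt_t.
  by rewrite leNgt (lt_le_trans gs gt).
have le_r : t <= maxn t N by apply: leq_maxl.
have := up (t - s0) (maxn t N - s0) (leq_sub2r _ le_r) I I.
rewrite /= !subnKC // ?(leq_trans le_t) // => g_up.
have /ltr_normlP [_] := HN (maxn t N) (leq_maxr _ _).
by rewrite ltrBlDr subrK ltNge (le_trans gt g_up).
Qed.

Lemma converges_lt g l q : converges_to g l -> (l < q)%R ->
  exists N, forall s, N <= s -> (g s < q)%R.
Proof.
move=> cvg lt_l; have [N HN] := cvg (q - l)%R (ltac:(by rewrite subr_gt0)).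
exists N => s /HN /ltr_normlP [_]; by rewrite ltrBlDr subrK.
Qed.

Lemma converges_gt g l q : converges_to g l -> (q < l)%R ->
  exists N, forall s, N <= s -> (q <= g s)%R.
Proof.
move=> cvg lt_l; have [N HN] := cvg (l - q)%R (ltac:(by rewrite subr_gt0)).
exists N => s /HN /ltr_normlP [+ _].
by rewrite opprB ltrBlDr addrAC -addrA ltrDl subr_gt0 => /ltW.
Qed.

Lemma NID_lt_third U x y :
  3 * Einf U x y < maxn (K U x) (K U y) -> (NID U x y < 3%:R^-1)%R.
Proof.
move=> lt_E; rewrite /NID ltr_pdivrMr ?ltr0n ?(leq_ltn_trans _ lt_E) //.
by rewrite mulrC ltr_pdivlMr ?ltr0n // -natrM ltr_nat mulnC.
Qed.

Lemma NID_gt_third U x y : universal_pf U ->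
  maxn (K U x) (K U y) < 3 * Einf U x y -> (3%:R^-1 < NID U x y)%R.
Proof.
move=> HU lt_E; rewrite /NID ltr_pdivlMr ?ltr0n ?leq_max ?K_gt0 //.
by rewrite mulrC ltr_pdivrMr ?ltr0n // -natrM ltr_nat mulnC.
Qed.

(** * The test words and their distances *)

(** For [i < 2 ^ m], the number [(2 ^ m).-1 + i] codes the [i]-th string of length [m]; index 0
    gives [0^m]. *)
Definition word m u i := pairN (pairN m u) ((2 ^ m).-1 + i).

Lemma word_inj m u i m' u' i' :
  word m u i = word m' u' i' -> [/\ m = m', u = u' & i = i'].
Proof.
by case/pairN_inj=> /pairN_inj [-> ->] /addnI ->.
Qed.

Lemma rec_word n F G H : recursive n F -> recursive n G -> recursive n H ->
  recursive n (fun a => word (F a) (G a) (H a)).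
Proof. by move=> *; rewrite /word; rec_solve. Qed.

Lemma size_payload m i : i < 2 ^ m -> size (decS ((2 ^ m).-1 + i)) = m.
Proof.
move=> lt_i; apply/eqP; rewrite size_decS expnS; have := expn_gt0 2 m; lia.
Qed.

Section Distance.
Variables (U : prog) (HU : universal_pf U).

Lemma Einf_word_le : exists c, forall m u i j, i < 2 ^ m -> j < 2 ^ m ->
  Einf U (decS (word m u i)) (decS (word m u j)) <= m + c.
Proof.
(* The program is the payload itself. Its length [m] is read from the condition, so for each
   condition the programs have equal length and form a prefix code. *)
pose P (k p z : nat) := 2 ^ pi1 (pi1 z) <= p.+1 < 2 ^ (pi1 (pi1 z)).+1.
have [||||c Hc] := @Kc_le_code U HU P (fun k p z => pairN (pi1 z) p).
- by apply: ternaryI; rewrite /P; rec_solve.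
- by apply: ternaryI; rec_solve.
- by [].
- move=> z p q; rewrite /P => -[_ Hp] [_ Hq] /prefix_eq_size; apply.
  by move: Hp Hq; rewrite -!size_decS !encSK => /eqP -> /eqP ->.
have Kc_word m u i j : i < 2 ^ m ->
    Kc U (decS (word m u i)) (decS (word m u j)) <= m + c.
  move=> lt_i; have := Hc 0 (decS ((2 ^ m).-1 + i)) (word m u j).
  rewrite /P /word !pi1K decSK size_payload //; apply.
  by rewrite -size_decS size_payload.
by exists c => m u i j lt_i lt_j; rewrite /Einf geq_max !Kc_word.
Qed.

(** The program [1^m 0 v] has length [2 m + 1], and [u] costs nothing since it is computed from [m].
    The certificate codes the pair of [m] and [v]. *)
Lemma K_word_le uu : unary uu -> exists c, forall m i, i < 2 ^ m ->
  K U (decS (word m (uu m) i)) <= 2 * m + c.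
Proof.
move=> uuR.
pose P (k p z : nat) := (p.+2 == 2 ^ pi1 k * (2 * pi2 k + 3)) &&
  (2 ^ pi1 k <= (pi2 k).+1 < 2 ^ (pi1 k).+1).
pose F (k p z : nat) := pairN (pairN (pi1 k) (uu (pi1 k))) (pi2 k).
have PE k p z : P k (encS p) z ->
    p = nseq (pi1 k) true ++ false :: decS (pi2 k) /\ size (decS (pi2 k)) = pi1 k.
  case/andP=> /eqP Ep; rewrite -size_decS => /eqP ->; split=> //.
  by apply: encS_inj; have := encS_unary (pi1 k) (decS (pi2 k)); rewrite decSK; lia.
have P_pre k k' p p' z : P k (encS p) z -> P k' (encS p') z -> prefix p p' ->
    pi1 k = pi1 k' /\ pi2 k = pi2 k'.
  move=> /PE [-> sk] /PE [-> sk'] /prefix_unary [E pre]; split=> //.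
  by rewrite -(decSK (pi2 k)) (prefix_eq_size pre) ?decSK // sk sk'.
have [||||c Hc] := @Kc_le_code U HU P F.
- by apply: ternaryI; rewrite /P; rec_solve.
- apply: ternaryI; rewrite /F; rec_solve.
  by apply: (rec_unary uuR); rec_solve.
- move=> k k' p z; rewrite -(decSK p) => Pk Pk'.
  by have [E1 E2] := P_pre _ _ _ _ _ Pk Pk' (prefix_refl _); rewrite /F E1 E2.
- move=> z p q [k Pk] [k' Pk'] pre.
  have [E1 E2] := P_pre _ _ _ _ _ Pk Pk' pre.
  by have [-> _] := PE _ _ _ Pk; have [-> _] := PE _ _ _ Pk'; rewrite E1 E2.
exists c.+1 => m i lt_i.
set v := decS ((2 ^ m).-1 + i).
have sv : size v = m by apply: size_payload.
have := Hc (pairN m (encS v)) (nseq m true ++ false :: v) 0.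
rewrite /P /F /word pi1K pi2K (encSK [::]) decSK encS_unary decSK eqxx /=.
rewrite -/(K U _) size_cat size_nseq /= sv => /(_ _) H.
apply: leq_trans (H _) _; last by lia.
by rewrite -size_decS -/v sv.
Qed.

Lemma Einf_word_const uu ii : unary ii -> exists c, forall m,
  Einf U (decS (word m (uu m) 0)) (decS (word m (uu m) (ii m))) <= c.
Proof.
move=> iiR.
pose P (k p z : nat) := 2 ^ 1 <= p.+1 < 2 ^ 2.
(* Programs are single bits, with codes 1 and 2, so [p.-1] selects payload index 0 or [ii m]; [m]
   and [u] come from the condition. *)
pose F (k p z : nat) :=
  pairN (pi1 z) ((2 ^ pi1 (pi1 z)).-1 + p.-1 * ii (pi1 (pi1 z))).
have [||||c Hc] := @Kc_le_code U HU P F.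
- by apply: ternaryI; rewrite /P; rec_solve.
- apply: ternaryI; rewrite /F; rec_solve.
  by apply: (rec_unary iiR); rec_solve.
- by [].
- move=> z p q [k Pp] [k' Pq] /prefix_eq_size; apply.
  by move: Pp Pq; rewrite /P -!size_decS !encSK => /eqP -> /eqP ->.
exists (1 + c) => m; rewrite /Einf geq_max.
have := Hc 0 [:: false] (word m (uu m) (ii m)).
have := Hc 0 [:: true] (word m (uu m) 0).
rewrite /P /F /word !pi1K /= mul0n mul1n => H1 H2.
by rewrite H2 // H1.
Qed.

End Distance.

Lemma rec_low n F : recursive n F -> recursive n (fun a => low (F a)).
Proof. by move=> RF; rewrite /low; rec_solve. Qed.

(** * Computable choice of [u_m] and [v_m] *)

Section Searches.
Variable L : nat -> nat -> nat -> bool.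
Hypothesis LR : ternary L.

Lemma search_all_low m0 :
  (forall m, m0 <= m -> exists u, forall i, i < 2 ^ m ->
     exists t, L (word m u 0) (word m u i) t) ->
  exists2 uu, unary uu & forall m, m0 <= m -> forall i, i < 2 ^ m ->
    exists t, L (word m (uu m) 0) (word m (uu m) i) t.
Proof.
move=> ex.
(* One number [k] both codes [u] and bounds the stages inspected. *)
pose P m k := all (fun i => has (fun t =>
  L (word m (pi1 k) 0) (word m (pi1 k) i) t) (iota 0 k)) (iota 0 (2 ^ m)).
have [||h hR hP] := @search_unary P m0.
- rewrite /P; apply: rec_all; first by rec_solve.
  apply: rec_has; first by rec_solve.
  by apply: (rec_ternary LR); do ?apply: rec_word; rec_solve.
- move=> m /ex [u Hu].
  (* Finitely many [i] share a stage bound [T], and [pairN u T] is at least [T]. *)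
  have [T HT] : exists T, forall i, i < 2 ^ m ->
      exists2 t, t < T & L (word m u 0) (word m u i) t.
    elim: (2 ^ m) Hu => [|n IH] Hu; first by exists 0.
    have [i lt_i|T HT] := IH; first exact/Hu/ltnW.
    have [t Lt] := Hu n (ltnSn n); exists (maxn T t.+1) => i.
    rewrite ltnS leq_eqVlt => /orP [/eqP ->|/HT [s lt_s Ls]].
      by exists t => //; rewrite leq_max ltnSn orbT.
    by exists s => //; rewrite leq_max lt_s.
  exists (pairN u T); rewrite /P pi1K; apply/allIotaP => i /HT [t lt_t Lt].
  by apply/hasIotaP; exists t => //; apply: leq_trans lt_t (leq_pairNr _ _).
exists (fun m => pi1 (h m)) => [|m /hP /allIotaP Hm i /Hm /hasIotaP [t _ Lt]].
  by apply: unaryI; apply: rec_pi1; apply: (rec_unary hR); rec_step.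
by exists t.
Qed.

Lemma search_rise uu m0 : unary uu ->
  (forall m, m0 <= m -> exists2 i, i < 2 ^ m & exists s t, [/\ s < t,
     L (word m (uu m) 0) (word m (uu m) i) s &
     ~~ L (word m (uu m) 0) (word m (uu m) i) t]) ->
  exists2 ii, unary ii & forall m, m0 <= m -> ii m < 2 ^ m /\
    exists s t, [/\ s < t, L (word m (uu m) 0) (word m (uu m) (ii m)) s &
     ~~ L (word m (uu m) 0) (word m (uu m) (ii m)) t].
Proof.
move=> uuR ex.
pose P m k := (pi1 k < 2 ^ m) && has (fun t => has (fun s =>
    L (word m (uu m) 0) (word m (uu m) (pi1 k)) s &&
    ~~ L (word m (uu m) 0) (word m (uu m) (pi1 k)) t) (iota 0 t)) (iota 0 k).
have [||h hR hP] := @search_unary P m0.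
- rewrite /P; apply: rec_andb; first by rec_solve.
  apply: rec_has; first by rec_solve.
  apply: rec_has; first by rec_solve.
  by apply: rec_andb; [|apply: rec_negb]; apply: (rec_ternary LR);
    do ?apply: rec_word; do ?apply: (rec_unary uuR); rec_solve.
- move=> m /ex [i lt_i [s [t [lt_st Ls Lt]]]]; exists (pairN i t.+1).
  rewrite /P pi1K lt_i; apply/hasIotaP; exists t; first exact: leq_pairNr.
  by apply/hasIotaP; exists s => //; rewrite Ls.
exists (fun m => pi1 (h m)) => [|m /hP /andP [lt_i]].
  by apply: unaryI; apply: rec_pi1; apply: (rec_unary hR); rec_step.
by case/hasIotaP=> t _ /hasIotaP [s lt_st /andP [Ls Lt]]; split=> //; exists s, t.
Qed.

End Searches.

(** * The contradiction *)

Theorem mainTheorem8 (U : prog) (HU : universal_pf U) : ~ Pi2 (NID U).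
Proof.
move=> [f [[[e He] cvg] oscf]].
pose L a b t := low (encQ (f (decS a) (decS b) t)).
have LR : ternary L.
  apply: ternaryI; apply: rec_low.
  apply: (@rec_ternary 3 (fun a b t => encQ (f (decS a) (decS b) t)));
    try exact: rec_nth.
  by exists e => a b t; have := He (decS a) (decS b) t; rewrite !decSK.
have LE a b t : L a b t = (f (decS a) (decS b) t < 3%:R^-1)%R by apply: lowE.
have [c1 Hc1] := Einf_word_le HU.
have [uu uuR uuL] : exists2 uu, unary uu & forall m, 3 * c1 < m ->
    forall i, i < 2 ^ m -> exists t, L (word m (uu m) 0) (word m (uu m) i) t.
  apply: search_all_low => // m lt_m.
  (* Complexity [4 * m] exceeds [3 * (m + c1)] because [3 * c1 < m]. *)
  have [|u _ Ku] := @Kc_count U HU (fun u => word m u 0) [::] (4 * m).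
    by move=> u u' /word_inj [].
  exists u => i lt_i.
  have /(converges_lt (cvg _ _)) [N HN] :
      (NID U (decS (word m u 0)) (decS (word m u i)) < 3%:R^-1)%R.
    apply: NID_lt_third; apply: leq_trans (leq_maxl _ _).
    apply: leq_trans Ku; have := Hc1 m u 0 i (expn_gt0 2 m) lt_i; lia.
  by exists N; rewrite LE HN.
have [c2 Hc2] := K_word_le HU uuR.
(* From [m1] on, [u_m] is valid and [2 * m + c2 < 3 * m], so distance at least [m] forces NID above
   1/3. *)
pose m1 := (3 * c1 + c2).+1.
have [ii iiR iiP] : exists2 ii, unary ii & forall m, m1 <= m -> ii m < 2 ^ m /\
    exists s t, [/\ s < t, L (word m (uu m) 0) (word m (uu m) (ii m)) s &
     ~~ L (word m (uu m) 0) (word m (uu m) (ii m)) t].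
  apply: search_rise => // m le_m.
  have [|i lt_i Ki] :=
      @Kc_count U HU (word m (uu m)) (decS (word m (uu m) 0)) m.
    by move=> i i' /word_inj [].
  exists i => //.
  have [|s Ls] := uuL m _ i lt_i; first by rewrite /m1 in le_m; lia.
  have /(converges_gt (cvg _ _)) [N HN] : (3%:R^-1 <
      NID U (decS (word m (uu m) 0)) (decS (word m (uu m) i)))%R.
    apply: NID_gt_third => //.
    have := Hc2 m 0 (expn_gt0 2 m); have := Hc2 m i lt_i.
    have : m <= Einf U (decS (word m (uu m) 0)) (decS (word m (uu m) i)).
      exact: leq_trans Ki (leq_maxr _ _).
    by rewrite gtn_max /m1 in le_m *; lia.
  (* A stage after [s] at which the limit above 1/3 is already visible. *)
  exists s, (maxn s.+1 N); split=> //; first exact: leq_maxl.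
  by rewrite LE -leNgt HN // leq_maxr.
have [c3 Hc3] := Einf_word_const HU uu iiR.
(* Counting over [m1 + j] gives a valid [m] for which the complexity of [y] exceeds [3 * c3]. *)
have [|j _ Kj] :=
    @Kc_count U HU (fun j => word (m1 + j) (uu (m1 + j)) 0) [::] (3 * c3).+1.
  by move=> j j' /word_inj [/addnI].
set m := m1 + j in Kj.
have [lt_i [s [t [lt_st Ls Lt]]]] := iiP m (leq_addr _ _).
rewrite !LE -leNgt in Ls Lt.
have := osc_limit_ge (oscf _ _) (cvg _ _) lt_st Ls Lt.
apply/negP; rewrite -ltNge.
apply: NID_lt_third; apply: leq_trans (leq_maxl _ _); apply: leq_trans Kj.
by rewrite ltnS leq_mul2l Hc3.
Qed.
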